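(* Let $n\ge 2$, let $\mathbb{A}$ and $\mathbb{B}$ be two $n$-ary algebras over $\mathbb{C}$ of the same finite dimension $k$, and let $i,j\in\mathbb{N}$. Suppose that $\mathbb{A}\to\mathbb{B}$ ($\mathbb{A}$ degenerates to $\mathbb{B}$) and that both $\mathbb{A}$ and $\mathbb{B}$ have $(i,j)$-invariants $c_{i,j}(\mathbb{A}), c_{i,j}(\mathbb{B})\in\mathbb{C}\cup\{\infty\}$. Then $c_{i,j}(\mathbb{A})=c_{i,j}(\mathbb{B})$.
   Context: All vector spaces are over $\mathbb{C}$. An $n$-ary algebra $\mathbb{A}$ is a vector space with an $n$-linear map $[\cdot,\dots,\cdot]:\mathbb{A}^n\to\mathbb{A}$. Degeneration: let $\mathbb{V}$ be a $k$-dimensional vector space. The space $\mathrm{Hom}(\mathbb{V}^{\otimes n},\mathbb{V})\cong\mathbb{C}^{k^{n+1}}$ of $n$-ary algebra structures on $\mathbb{V}$ (with coordinates the structure constants in a fixed basis) carries the Zariski topology, and $GL(\mathbb{V})$ acts on it by $(g*\mu)(x_1\otimes\dots\otimes x_n)=g\mu(g^{-1}x_1\otimes\dots\otimes g^{-1}x_n)$. $O(\mu)$ is the orbit of $\mu$. If $\mu,\lambda$ are structures on $\mathbb{V}$ representing (i.e. giving algebras isomorphic to) $\mathbb{A}$ and $\mathbb{B}$, then $\mathbb{A}\to\mathbb{B}$ means that $\lambda$ lies in the Zariski closure $\overline{O(\mu)}$. Trace invariants: a fundamental object of $\mathbb{A}$ is an element $X=(X_1,\dots,X_{n-1})\in\mathbb{A}^{n-1}$.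 It defines the linear map $R_X:\mathbb{A}\to\mathbb{A}$, $R_XZ=[Z,X_1,\dots,X_{n-1}]$. The algebra $\mathbb{A}$ has an $(i,j)$-invariant in exactly the following two cases. (1) If there exists a unique constant $c\in\mathbb{C}$ such that $\mathrm{tr}(R_X^i)\,\mathrm{tr}(R_Y^j)=c\,\mathrm{tr}(R_X^i\circ R_Y^j)$ for all fundamental objects $X,Y$ of $\mathbb{A}$, then $c_{i,j}(\mathbb{A}):=c$. (2) If $\mathrm{tr}(R_X^i\circ R_Y^j)=0$ for all fundamental objects $X,Y$ and there exist fundamental objects $X,Y$ with $\mathrm{tr}(R_X^i)\,\mathrm{tr}(R_Y^j)\neq 0$, then $c_{i,j}(\mathbb{A}):=\infty$. *)

(* Defs.v *)
From HB Require Import structures.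
From mathcomp Require Import all_boot all_order all_algebra.
From mathcomp Require Import mpoly.
From mathcomp Require Import complex classical_sets reals.

Set Implicit Arguments.
Unset Strict Implicit.
Unset Printing Implicit Defensive.

Import GRing.Theory.
Local Open Scope classical_set_scope.
Local Open Scope ring_scope.

Section Structures.
Variables (F : fieldType) (n : nat).

Definition set_arg (V : Type) (x : n.-tuple V) (i : 'I_n) (u : V) : n.-tuple V :=
  [tuple if j == i then u else tnth x j | j < n].

Definition multilinear (V W : lmodType F) (f : n.-tuple V -> W) : Prop :=
  forall (x : n.-tuple V) (i : 'I_n) (a : F) (u v : V),
    f (set_arg x i (a *: u + v)) = a *: f (set_arg x i u) + f (set_arg x i v).

(* The elements of Hom(V^{(x) n}, V). *)
Record nary_structure (V : vectType F) := NaryStructure {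
  nary_op :> n.-tuple V -> V;
  nary_opP : multilinear nary_op }.

Record nary_algebra := NaryAlgebra {
  carrier :> vectType F;
  bracket : nary_structure carrier }.

Definition bijective_lfun (V W : vectType F) (f : 'Hom(V, W)) : Prop :=
  lker f = 0%VS /\ limg f = fullv.

Definition isomorphic (A B : nary_algebra) : Prop :=
  exists2 f : 'Hom(A, B), bijective_lfun f &
    forall x : n.-tuple A, f (bracket A x) = bracket B (map_tuple f x).

Definition represents (V : vectType F) (mu : nary_structure V)
  (A : nary_algebra) : Prop := isomorphic (NaryAlgebra mu) A.

Section Space.
Variable V : vectType F.

Fact gl_act_multilinear (g : 'End(V)) (mu : nary_structure V) :
  multilinear (fun x : n.-tuple V => g (mu (map_tuple (g^-1)%VF x))).
Proof.
have E x i u : map_tuple (g^-1)%VF (set_arg x i u) =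
               set_arg (map_tuple (g^-1)%VF x) i ((g^-1)%VF u).
  by apply: eq_from_tnth => j; rewrite !(tnth_map, tnth_mktuple); case: eqP.
by move=> x i a u v; rewrite !E !linearP nary_opP linearP.
Qed.

Definition gl_act (g : 'End(V)) (mu : nary_structure V) : nary_structure V :=
  NaryStructure (gl_act_multilinear g mu).

Definition orbit_of (mu : nary_structure V) : set (nary_structure V) :=
  [set nu | exists2 g : 'End(V), bijective_lfun g & nu = gl_act g mu].

(* The structure constants in the basis e_0, ..., e_(k-1) of V fixed by
   vbasis: the index (t, l) stands for the coefficient of e_l in
   [e_(t 0), ..., e_(t (n-1))]. There are k^(n+1) of them. *)
Definition sc_index : finType :=
  (n.-tuple 'I_(\dim {:V}) * 'I_(\dim {:V}))%type.

Definition structure_constant (mu : nary_structure V) (s : sc_index) : F :=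
  coord (vbasis {:V}) s.2 (mu (map_tuple (tnth (vbasis {:V})) s.1)).

Definition sc_point (mu : nary_structure V) (s : 'I_#|sc_index|) : F :=
  structure_constant mu (enum_val s).

Definition zero_locus (S : set {mpoly F[#|sc_index|]}) :
    set (nary_structure V) :=
  [set mu | forall p, S p -> meval (sc_point mu) p = 0].

Definition zariski_closed (Z : set (nary_structure V)) : Prop :=
  exists S, Z = zero_locus S.

Definition zariski_closure (Z : set (nary_structure V)) :
    set (nary_structure V) :=
  smallest zariski_closed Z.

End Space.

Definition degenerates (A B : nary_algebra) : Prop :=
  exists (V : vectType F) (mu la : nary_structure V),
    [/\ represents mu A, represents la B & zariski_closure (orbit_of mu) la].

Definition lfun_trace (V : vectType F) (f : 'End(V)) : F :=
  \tr (passmx.mxof (vbasis {:V}) (vbasis {:V}) f).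

Definition lfun_pow (V : vectType F) (f : 'End(V)) (i : nat) : 'End(V) :=
  iter i (fun h => (f \o h)%VF) \1%VF.

Section Invariants.
Variable A : nary_algebra.

Definition fundamental_object := n.-1.-tuple A.

(* For n > 0 the sequence Z :: X has length n, so that the default value of
   nth is irrelevant, and the function of Z is linear, so that linfun
   agrees with it. *)
Definition Rmul (X : fundamental_object) : 'End(A) :=
  linfun (fun Z : A => bracket A [tuple nth 0 (Z :: X) l | l < n]).

Definition trace_prod (i j : nat) (X Y : fundamental_object) : F :=
  lfun_trace (lfun_pow (Rmul X) i) * lfun_trace (lfun_pow (Rmul Y) j).

Definition trace_comp (i j : nat) (X Y : fundamental_object) : F :=
  lfun_trace (lfun_pow (Rmul X) i \o lfun_pow (Rmul Y) j)%VF.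

End Invariants.

Inductive with_infty := Fin of F | Infty.

(* has_invariant A i j c: A has an (i,j)-invariant and its value is c. *)
Definition has_invariant (A : nary_algebra) (i j : nat) (c : with_infty) :
    Prop :=
  match c with
  | Fin c => unique (fun c' : F => forall X Y : fundamental_object A,
      trace_prod i j X Y = c' * trace_comp i j X Y) c
  | Infty => (forall X Y : fundamental_object A, trace_comp i j X Y = 0) /\
      (exists X Y : fundamental_object A, trace_prod i j X Y <> 0)
  end.

End Structures.

(* Main.v *)
Require Import Defs.
From HB Require Import structures.
From mathcomp Require Import all_boot all_order all_algebra.
From mathcomp Require Import mpoly.
From mathcomp Require Import complex classical_sets reals.

Set Implicit Arguments.
Unset Strict Implicit.
Unset Printing Implicit Defensive.

Import GRing.Theory.
Local Open Scope ring_scope.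

(** Say that an algebra satisfies the trace relation with coefficients
    [(a, b)] when [a tr(R_X^i) tr(R_Y^j) = b tr(R_X^i R_Y^j)] for all
    fundamental objects [X] and [Y].  Both kinds of invariant contain such a
    relation: a finite value [c] gives the coefficients [(1, c)], the value
    infinity gives [(0, 1)].

    A trace relation passes along degenerations ([degenerates_relation]).
    It is invariant under isomorphism, because an isomorphism conjugates the
    operators [R_X] ([isomorphic_relation]); hence it holds on a whole orbit as
    soon as it holds at one point.  It is also a Zariski closed condition on the
    structure ([closed_relation]): by multilinearity the entries of the matrix
    of [R_X] are, for fixed [X], linear combinations of structure constants,
    so both traces are polynomials in the structure constants.

    Therefore [B] inherits the relation of [A], and comparing it with the
    invariant of [B] leaves no freedom.  If [A] has the finite value [a], then
    [a] satisfies the identity which the value of [B], if finite, is alone to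
    satisfy, while an infinite value of [B] would make the products of traces
    vanish.  If [A] has the value infinity, the traces of compositions vanish
    on [B], so no constant, or every constant, satisfies the identity for [B]:
    [B] has no finite value. *)

(** * Multilinear maps, one slot at a time *)

Section Slots.
Variables (F : fieldType) (n : nat) (V W : lmodType F).
Variables (f : n.-tuple V -> W) (f_lin : multilinear f).

Lemma set_arg_id (x : n.-tuple V) i : set_arg x i (tnth x i) = x.
Proof. by apply: eq_from_tnth => j; rewrite tnth_mktuple; case: eqP => // ->. Qed.

Lemma multilinear_sum (x : n.-tuple V) i (J : finType) (c : J -> F) v :
  f (set_arg x i (\sum_j c j *: v j)) = \sum_j c j *: f (set_arg x i (v j)).
Proof.
pose g u := f (set_arg x i u).
have g_lin : linear g by move=> a u w; apply: f_lin.
pose L : {linear V -> W} := HB.pack g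
  (GRing.isSemilinear.Build F V W _ g (GRing.semilinear_linear g_lin)).
rewrite -[LHS]/(L _) linear_sum; apply: eq_bigr => j _.
by rewrite linearZ.
Qed.

End Slots.

Section Multiplication.
Variables (F : fieldType) (n : nat) (n_gt0 : (0 < n)%N).

(** Since [0 < n], the bracket has a first slot; filling it is a linear map,
    which is what makes [linfun] agree with the underlying function. *)
Lemma RmulE (A : nary_algebra F n) (X : fundamental_object A) (Z : A) :
  Rmul X Z = bracket A [tuple nth 0 (Z :: X) l | l < n].
Proof.
pose g (U : A) := bracket A [tuple nth 0 (U :: X) l | l < n].
have gE U : g U = bracket A (set_arg [tuple nth 0 ((0 : A) :: X) l | l < n]
                                    (Ordinal n_gt0) U).
  congr (bracket A _); apply: eq_from_tnth => j.
  by rewrite !tnth_mktuple -val_eqE /=; case: (nat_of_ord j).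
have g_lin : linear g by move=> a u w; rewrite !gE nary_opP.
pose L : {linear A -> A} := HB.pack g
  (GRing.isSemilinear.Build F A A _ g (GRing.semilinear_linear g_lin)).
exact: (lfunE L).
Qed.

(** * Invariance under isomorphism *)

Lemma mxof_vbasis_comp (U V W : vectType F) (f : 'Hom(U, V)) (h : 'Hom(V, W)) :
  passmx.mxof (vbasis {:U}) (vbasis {:W}) (h \o f)%VF =
  passmx.mxof (vbasis {:U}) (vbasis {:V}) f *m
  passmx.mxof (vbasis {:V}) (vbasis {:W}) h.
Proof. by apply: passmx.mxof_comp => //; apply: vbasisP. Qed.

Lemma lfun_traceC (V W : vectType F) (f : 'Hom(V, W)) (h : 'Hom(W, V)) :
  lfun_trace (h \o f)%VF = lfun_trace (f \o h)%VF.
Proof. by rewrite /lfun_trace !mxof_vbasis_comp mxtrace_mulC. Qed.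

Lemma lfun_trace_conj (V W : vectType F) (f : 'Hom(V, W)) h h' :
  bijective_lfun f -> (f \o h = h' \o f)%VF -> lfun_trace h = lfun_trace h'.
Proof.
move=> [/eqP f_inj f_surj] fh.
have f_invr : (f \o f^-1 = \1)%VF.
  by apply/lfunP => u; rewrite !lfunE /= limg_lfunVK // f_surj memvf.
rewrite -[h]comp_lfun1l -(lker0_compVf f_inj) -comp_lfunA fh.
by rewrite lfun_traceC -comp_lfunA f_invr comp_lfun1r.
Qed.

Lemma lfun_pow_conj (V W : vectType F) (f : 'Hom(V, W)) h h' i :
  (f \o h = h' \o f)%VF -> (f \o lfun_pow h i = lfun_pow h' i \o f)%VF.
Proof.
move=> fh; elim: i => [|i IHi]; first by rewrite comp_lfun1l comp_lfun1r.
by rewrite /= comp_lfunA fh -comp_lfunA IHi comp_lfunA.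
Qed.

Definition trace_relation (A : nary_algebra F n) i j a b :=
  forall X Y : fundamental_object A,
    a * trace_prod i j X Y = b * trace_comp i j X Y.

Section Isomorphism.
Variables (A B : nary_algebra F n) (f : 'Hom(A, B)).
Hypothesis f_bij : bijective_lfun f.
Hypothesis f_mor :
  forall x : n.-tuple A, f (bracket A x) = bracket B (map_tuple f x).

Lemma Rmul_conj (X : fundamental_object A) :
  (f \o Rmul X = Rmul (map_tuple f X : fundamental_object B) \o f)%VF.
Proof.
apply/lfunP => Z; rewrite !lfunE /= !RmulE f_mor; congr (bracket B _).
apply: eq_from_tnth => l; rewrite tnth_map !tnth_mktuple.
rewrite -[f Z :: _]/[seq f u | u <- Z :: X] (nth_map 0) //=.
by rewrite size_tuple prednK.
Qed.

Lemma trace_prod_conj i j (X Y : fundamental_object A) :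
  trace_prod i j X Y =
  trace_prod i j (map_tuple f X : fundamental_object B)
    (map_tuple f Y : fundamental_object B).
Proof.
by congr (_ * _); apply: (lfun_trace_conj f_bij);
  apply: lfun_pow_conj; apply: Rmul_conj.
Qed.

Lemma trace_comp_conj i j (X Y : fundamental_object A) :
  trace_comp i j X Y =
  trace_comp i j (map_tuple f X : fundamental_object B)
    (map_tuple f Y : fundamental_object B).
Proof.
apply: (lfun_trace_conj f_bij).
have conjX := lfun_pow_conj i (Rmul_conj X).
have conjY := lfun_pow_conj j (Rmul_conj Y).
by rewrite comp_lfunA conjX -comp_lfunA conjY comp_lfunA.
Qed.

Lemma map_tuple_bij_surj (X : fundamental_object B) :
  exists Y : fundamental_object A, X = map_tuple f Y.
Proof.
exists (map_tuple f^-1%VF X); apply: eq_from_tnth => l.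
by rewrite !tnth_map limg_lfunVK // f_bij.2 memvf.
Qed.

End Isomorphism.

Lemma isomorphic_relation (A B : nary_algebra F n) i j a b :
  isomorphic A B -> (trace_relation A i j a b <-> trace_relation B i j a b).
Proof.
case=> f f_bij f_mor; split=> rel X Y; last first.
  by rewrite (trace_prod_conj f_bij f_mor) (trace_comp_conj f_bij f_mor).
have [X' ->] := map_tuple_bij_surj f_bij X.
have [Y' ->] := map_tuple_bij_surj f_bij Y.
by rewrite -(trace_prod_conj f_bij f_mor) -(trace_comp_conj f_bij f_mor).
Qed.

Lemma gl_act_isomorphic (V : vectType F) (g : 'End(V))
    (mu : nary_structure n V) :
  bijective_lfun g -> isomorphic (NaryAlgebra mu) (NaryAlgebra (gl_act g mu)).
Proof.
move=> g_bij; exists g => //= x; congr (g (mu _)).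
apply: eq_from_tnth => l; rewrite !tnth_map lker0_lfunK //.
by apply/eqP; case: g_bij.
Qed.

(** * Functions that are polynomial in the structure constants *)

Section Polynomial.
Variable V : vectType F.
Local Notation e := (vbasis {:V}).
Local Notation k := (\dim {:V}).
Implicit Types phi psi : nary_structure n V -> F.

Definition polynomial phi :=
  exists p, forall mu, phi mu = meval (sc_point mu) p.

Lemma polynomial_const c : polynomial (fun=> c).
Proof. by exists c%:MP => mu; rewrite mevalC. Qed.

Lemma polynomialD phi psi :
  polynomial phi -> polynomial psi -> polynomial (fun mu => phi mu + psi mu).
Proof.
by case=> p phiE [q psiE]; exists (p + q) => mu; rewrite mevalD phiE psiE.
Qed.

Lemma polynomialM phi psi :
  polynomial phi -> polynomial psi -> polynomial (fun mu => phi mu * psi mu).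
Proof.
by case=> p phiE [q psiE]; exists (p * q) => mu; rewrite mevalM phiE psiE.
Qed.

Lemma polynomial_sum (J : finType) (phi : J -> nary_structure n V -> F) :
  (forall t, polynomial (phi t)) -> polynomial (fun mu => \sum_t phi t mu).
Proof.
move=> /fin_all_exists [p phiE]; exists (\sum_t p t) => mu.
by rewrite raddf_sum; apply: eq_bigr => t _; apply: phiE.
Qed.

Lemma eq_polynomial phi psi :
  (forall mu, phi mu = psi mu) -> polynomial psi -> polynomial phi.
Proof. by move=> E [p psiE]; exists p => mu; rewrite E. Qed.

Lemma polynomial_structure_constant s :
  polynomial (fun mu => structure_constant mu s).
Proof.
by exists 'X_(enum_rank s) => mu; rewrite mevalXU /sc_point enum_rankK.
Qed.

(** Arguments that are basis vectors give structure constants; the others are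
    expanded in the basis one slot at a time, here from the first slot on. *)
Lemma polynomial_coord_bracket (x : n.-tuple V) l :
  polynomial (fun mu => coord e l (mu x)).
Proof.
suff expand m : (m <= n)%N -> forall x : n.-tuple V,
    (forall i : 'I_n, (m <= i)%N -> tnth x i \in (e : seq V)) ->
    polynomial (fun mu => coord e l (mu x)).
  by apply: (expand n) => // i; rewrite leqNgt ltn_ord.
elim: m => [_ {}x x_basis | m IHm m_lt {}x x_basis].
  have /fin_all_exists [t xE] i : exists t, tnth x i = tnth e t.
    by apply/tnthP/x_basis.
  apply: eq_polynomial (polynomial_structure_constant (mktuple t, l)) => mu.
  congr (coord _ _ (mu _)); apply: eq_from_tnth => i.
  by rewrite xE tnth_map tnth_mktuple.
pose i := Ordinal m_lt.
apply: (@eq_polynomial _ (fun mu => \sum_t coord e t (tnth x i) *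
          coord e l (mu (set_arg x i e`_t)))) => [mu|].
  rewrite -{1}[x](set_arg_id _ i).
  rewrite {1}[tnth x i](coord_vbasis (memvf _)).
  rewrite multilinear_sum ?linear_sum; last exact: nary_opP.
  by apply: eq_bigr => t _; rewrite linearZ.
apply: polynomial_sum => t; apply: polynomialM; first exact: polynomial_const.
apply: IHm (ltnW m_lt) _ _ => h m_le_h; rewrite tnth_mktuple.
case: eqP => [_ | /eqP h_neq_i]; first by rewrite mem_nth // size_tuple.
by apply: x_basis; rewrite ltn_neqAle m_le_h andbT eq_sym.
Qed.

Definition polynomial_mx (M : nary_structure n V -> 'M[F]_k) :=
  forall r s, polynomial (fun mu => M mu r s).

Lemma polynomial_mulmx M N :
  polynomial_mx M -> polynomial_mx N ->
  polynomial_mx (fun mu => M mu *m N mu).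
Proof.
move=> Mp Np r s.
apply: (@eq_polynomial _ (fun mu => \sum_t M mu r t * N mu t s)) => [mu|].
  by rewrite mxE.
by apply: polynomial_sum => t; apply: polynomialM.
Qed.

Lemma polynomial_mxtrace M :
  polynomial_mx M -> polynomial (fun mu => \tr (M mu)).
Proof. by move=> Mp; apply: polynomial_sum => t; apply: Mp. Qed.

Definition Rmul_at (X : n.-1.-tuple V) (mu : nary_structure n V) : 'End(V) :=
  @Rmul F n (NaryAlgebra mu) X.

(** Row [r] of the matrix of [R_X] lists the coordinates of [R_X e_r], a
    bracket of fixed vectors; powers are then matrix products. *)
Lemma polynomial_Rmul_pow X i :
  polynomial_mx (fun mu => passmx.mxof e e (lfun_pow (Rmul_at X mu) i)).
Proof.
elim: i => [|i IHi].
  move=> r s; apply: (@eq_polynomial _ (fun=> (1%:M : 'M[F]_k) r s)).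
    by move=> mu; rewrite passmx.mxof1 ?(basis_free (vbasisP _)).
  exact: polynomial_const.
move=> r s; apply: (@eq_polynomial _ (fun mu =>
    (passmx.mxof e e (lfun_pow (Rmul_at X mu) i) *m
     passmx.mxof e e (Rmul_at X mu)) r s)) => [mu|].
  by rewrite -mxof_vbasis_comp.
move: r s; apply: polynomial_mulmx => // r s.
apply: (@eq_polynomial _ (fun mu => coord e s
    (mu [tuple nth 0 (e`_r :: X) l | l < n]))) => [mu|].
  rewrite !mxE /= passmx.vecof_delta.
  by rewrite (@RmulE (NaryAlgebra mu)).
exact: polynomial_coord_bracket.
Qed.

Lemma polynomial_trace_prod i j (X Y : n.-1.-tuple V) :
  polynomial (fun mu => @trace_prod F n (NaryAlgebra mu) i j X Y).
Proof.
by apply: polynomialM; apply: polynomial_mxtrace; apply: polynomial_Rmul_pow.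
Qed.

Lemma polynomial_trace_comp i j (X Y : n.-1.-tuple V) :
  polynomial (fun mu => @trace_comp F n (NaryAlgebra mu) i j X Y).
Proof.
apply: (@eq_polynomial _ (fun mu => \tr
    (passmx.mxof e e (lfun_pow (Rmul_at Y mu) j) *m
     passmx.mxof e e (lfun_pow (Rmul_at X mu) i)))) => [mu|].
  by rewrite -mxof_vbasis_comp.
by apply/polynomial_mxtrace/polynomial_mulmx; apply: polynomial_Rmul_pow.
Qed.

(** Each pair of fundamental objects contributes one equation, polynomial in
    [mu] because [X] and [Y] range over the tuples of the fixed space [V],
    which do not depend on [mu]. *)
Lemma closed_relation i j a b :
  @zariski_closed F n V (fun mu => trace_relation (NaryAlgebra mu) i j a b).
Proof.
exists (fun p => exists X Y : n.-1.-tuple V, forall mu : nary_structure n V,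
  meval (sc_point mu) p =
  a * @trace_prod F n (NaryAlgebra mu) i j X Y +
  - b * @trace_comp F n (NaryAlgebra mu) i j X Y).
apply/seteqP; split=> [mu rel p [X [Y ->]] | mu locus X Y].
  by rewrite mulNr rel subrr.
have [p pE] : polynomial (fun nu =>
    a * @trace_prod F n (NaryAlgebra nu) i j X Y +
    - b * @trace_comp F n (NaryAlgebra nu) i j X Y).
  apply: polynomialD; apply: polynomialM; try exact: polynomial_const.
    exact: polynomial_trace_prod.
  exact: polynomial_trace_comp.
apply/eqP; rewrite -subr_eq0 -mulNr pE; apply/eqP/locus.
by exists X, Y => nu; rewrite pE.
Qed.

End Polynomial.

(** * Invariants along a degeneration *)

(** The closure of the orbit lies in every closed set containing the orbit, in
    particular in the set of structures that satisfy the relation. *)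
Lemma degenerates_relation (A B : nary_algebra F n) i j a b :
  degenerates A B -> trace_relation A i j a b -> trace_relation B i j a b.
Proof.
move=> [V [mu [la [muA laB la_closure]]]] relA.
apply/(isomorphic_relation _ _ _ _ laB).
move: la la_closure {laB}; apply: smallest_sub.
  exact: closed_relation.
move=> _ [g g_bij ->].
apply/(isomorphic_relation _ _ _ _ (gl_act_isomorphic mu g_bij)).
exact/(isomorphic_relation _ _ _ _ muA).
Qed.

End Multiplication.

Theorem lemma2 (R : realType) (n k : nat) (A B : nary_algebra R[i]%C n)
  (i j : nat) (cA cB : with_infty R[i]%C) :
  (2 <= n)%N ->
  \dim {: carrier A} = k -> \dim {: carrier B} = k ->
  degenerates A B ->
  has_invariant A i j cA -> has_invariant B i j cB ->
  cA = cB.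
Proof.
move=> n_ge2 _ _ degAB; have n_gt0 := ltnW n_ge2.
case: cA cB => [a|] [b|] //=.
- move=> [relA _] [_ b_unique]; congr Fin; apply/esym/b_unique => X Y.
  rewrite -[LHS]mul1r; apply: (degenerates_relation n_gt0 degAB) => {}X {}Y.
  by rewrite mul1r relA.
- move=> [relA _] [compB [X [Y []]]].
  rewrite -[LHS]mul1r (degenerates_relation n_gt0 degAB (b := a)) ?compB ?mulr0 //.
  by move=> {}X {}Y; rewrite mul1r relA.
- move=> [compA _] [relB b_unique].
  have compB (X Y : fundamental_object B) : trace_comp i j X Y = 0.
    rewrite -[LHS]mul1r -(degenerates_relation n_gt0 degAB (a := 0)) ?mul0r //.
    by move=> {}X {}Y; rewrite compA mul0r mulr0.
  (* The constant b + 1 satisfies the same identity as b. *)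
  have /eqP : b = b + 1 by apply: b_unique => X Y; rewrite relB compB !mulr0.
  by rewrite -subr_eq0 opprD addNKr oppr_eq0 oner_eq0.
Qed.
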